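(* Let $m,n$ be positive integers and consider the random walk on $(\mathbb{Z}/m\mathbb{Z})^n$ which at each step stays put with probability $\frac12$ and, for each $1\le j\le n$ and each sign, adds $\pm e_j$ with probability $\frac{1}{4n}$. Let $\tilde P^{*\ell}_x$ be its law after $\ell$ steps started from $x$ and $U$ the uniform measure. If $\ell=\frac12 m^2\big((n+1)\log(mn)+c(n+1)\big)$, then for every $x\in(\mathbb{Z}/m\mathbb{Z})^n$, $$4\lVert\tilde P_x^{*\ell}-U\rVert_{T.V.}^2\le\left(1+\frac{1}{n^n}\right)e^{-c}.$$
   Context: $e_1,\dots,e_n$ is the standard basis of $(\mathbb{Z}/m\mathbb{Z})^n$. The walk is generated by the measure $\tilde P(\pm e_j)=\frac{1}{4n}$ for $1\le j\le n$, $\tilde P(\mathrm{id})=\frac12$, where $\mathrm{id}$ is the zero vector (weights are added when some of these elements coincide), with transition matrix $\tilde P(x,x+g)=\tilde P(g)$. $\lVert \mu-\nu\rVert_{T.V.}=\sup_A|\mu(A)-\nu(A)|$. $\log$ is the natural logarithm. Since $\ell$ is a number of steps, $c$ is a real number understood to be such that $\ell$ is a nonnegative integer. *)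

(* Defs.v *)
From HB Require Import structures.
From mathcomp Require Import all_boot all_order all_algebra.
From mathcomp Require Import all_classical all_reals all_analysis.

Set Implicit Arguments.
Unset Strict Implicit.
Unset Printing Implicit Defensive.

Import Order.TTheory GRing.Theory Num.Theory.

Local Open Scope ring_scope.

(* Z/mZ for m >= 1. The library's 'Z_m would be Z/2Z for m = 1, whereas
   'I_m.-1.+1 carries addition modulo m for every m >= 1, including the
   trivial group for m = 1. *)
Definition zmod (m : nat) : finZmodType := 'I_m.-1.+1.

Definition torus (m n : nat) : finZmodType := 'rV[zmod m]_n.

(* inZp 1 is the class of 1, which is 0 when m = 1. *)
Definition basis_vec (m n : nat) (j : 'I_n) : torus m n :=
  \row_(i < n) (if i == j then inZp 1 : 'I_m.-1.+1 else 0).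

(* Measures on a finite type are given by their mass functions. *)
Section FiniteMeasures.
Variables (R : realType) (T : finType).

Definition measure_of (mu : T -> R) (A : {set T}) : R := \sum_(y in A) mu y.

Definition uniform_mass : T -> R := fun=> #|T|%:R^-1.

Definition tv_norm (mu nu : T -> R) : R :=
  sup [set `|measure_of mu A - measure_of nu A| | A in [set: {set T}]]%classic.

End FiniteMeasures.

Section RandomWalks.
Variables (R : realType) (G : finZmodType) (P : G -> R).

Definition walk_kernel (x y : G) : R := P (y - x).

Fixpoint walk_law (l : nat) (x : G) : G -> R :=
  if l is l'.+1 then fun y => \sum_(z : G) walk_law l' x z * walk_kernel z y
  else fun y => (y == x)%:R.

End RandomWalks.

(* Written as a sum over the generators, so that the weights of coinciding
   generators (m <= 2) add up. *)
Definition lazy_step (R : realType) (m n : nat) (g : torus m n) : R :=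
  2^-1 * (g == 0)%:R +
  \sum_(j < n) ((4 * n%:R)^-1 * (g == basis_vec m j)%:R +
                (4 * n%:R)^-1 * (g == - basis_vec m j)%:R).

(* Main.v *)
Require Import Defs.
From HB Require Import structures.
From mathcomp Require Import all_boot all_order all_algebra.
From mathcomp Require Import all_classical all_reals all_analysis.
From mathcomp Require Import ring lra zify.

Set Implicit Arguments.
Unset Strict Implicit.
Unset Printing Implicit Defensive.

Import Order.TTheory GRing.Theory Num.Theory.

Local Open Scope ring_scope.

(** The walk is diagonalised by the characters of the torus, and since its
    step is symmetric only their real parts are needed, so no complex numbers
    occur.  For k in the torus put
    chi_k(y) = cos (2 pi (k . y) / m), where k . y is the sum of the k_j y_j.
    The d'Alembert equation chi(y + a) + chi(y - a) = 2 chi(a) chi(y)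
    ([chi_dAlembert]) does double duty.  With a = e_j it says that averaging
    over +e_j and -e_j multiplies chi_k by cos (2 pi k_j / m), so that chi_k
    is an eigenfunction of the walk ([lazy_step_eigen]).  Summed over the
    group, in either variable since chi_k(y) = chi_y(k), it forces the sum of
    the chi_k(y) over k to vanish unless y = 0 ([chi_orth]).

    These two facts give a Plancherel identity for the law of the walk
    ([walk_law_plancherel]); with Cauchy-Schwarz it yields the upper bound
    lemma
    4 TV^2 <= sum over k <> 0 of lam_k^(2l)   ([lazy_tv_spectral]).
    Here lam_k = 1 - (1/2n) sum_j (1 - cos (2 pi k_j / m)) is nonnegative
    because the walk is lazy, it is at most the exponential of lam_k - 1, and
    1 - cos (2 pi N / m) >= 8 / m^2 for 0 < N < m by Jordan's inequality.  Hence
    lam_k^(2l) is bounded by a product over the coordinates, and the sum over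
    k factors as a power ([lazy_tv_product]).

    Write q = exp (- (ln (mn) + c)), so that the target exp (- c) is m n q.
    The number of steps is chosen so that every nonzero coordinate costs a
    factor at most q^4, and l >= 0 means q <= 1.  What remains is
    (1 + (m - 1) q^4)^n - 1 <= m n q.  This can fail for q near 1, but
    when m n q >= 4 the claim is just TV <= 1; for m n q < 4 it is
    [product_bound]. *)

(** * Total variation and the L2 norm *)

(** Cauchy-Schwarz against the constant function, obtained from the
    nonnegativity of the variance of [f]. *)
Lemma sqr_sum_le (R : realType) (T : finType) (f : T -> R) :
  (\sum_y f y) ^+ 2 <= #|T|%:R * \sum_y f y ^+ 2.
Proof.
set s := \sum_y f y; set N : R := #|T|%:R; set q := \sum_y f y ^+ 2.
have [T0|T_gt0] := posnP #|T|.
  rewrite /s big1 ?expr0n /= ?mulr_ge0 ?ler0n ?sumr_ge0 // => [y _|y _].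
    exact: sqr_ge0.
  by have := card0_eq T0 y; rewrite inE.
have N_gt0 : 0 < N by rewrite ltr0n.
have : 0 <= \sum_y (N * f y - s) ^+ 2 by apply: sumr_ge0 => y _; exact: sqr_ge0.
have -> : \sum_y (N * f y - s) ^+ 2 = N * (N * q - s ^+ 2).
  under eq_bigr => y _.
    have -> : (N * f y - s) ^+ 2 =
      N ^+ 2 * f y ^+ 2 + (- (N * s) *+ 2) * f y + s ^+ 2 by ring.
    over.
  rewrite !big_split /= sumr_const -!mulr_sumr -/q -/s -[s ^+ 2 *+ _]mulr_natr.
  by rewrite -/N; ring.
by rewrite pmulr_rge0 // subr_ge0.
Qed.

Section TotalVariation.
Variables (R : realType) (T : finType) (mu nu : T -> R).

(** A supremum inherits bounds only when it is taken over a nonempty bounded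
    set, hence the detour through [S0] and [SB]. *)
Lemma tv_norm_le (B : R) :
  (forall A : {set T}, `|measure_of mu A - measure_of nu A| <= B) ->
  0 <= tv_norm mu nu <= B.
Proof.
move=> muB; pose S := [set `|measure_of mu A - measure_of nu A|
  | A in [set: {set T}]]%classic.
have S0 : S `|measure_of mu finset.set0 - measure_of nu finset.set0|.
  by exists finset.set0.
have SB : ubound S B by move=> _ [A _ <-].
apply/andP; split; last by apply: ge_sup => //; exact: (ex_intro _ _ S0).
by apply: (le_trans (normr_ge0 _) (ub_le_sup _ S0)); exists B.
Qed.

Hypothesis mass_eq : \sum_y mu y = \sum_y nu y.

(** Twice [mu A - nu A] is the sum of [mu - nu] over [A] minus its sum over the
    complement of [A], as the two sums are opposite; hence it is a signed sum
    over all points, to which Cauchy-Schwarz applies. *)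
Lemma tv_norm_sqr_le :
  4 * tv_norm mu nu ^+ 2 <= #|T|%:R * \sum_y (mu y - nu y) ^+ 2.
Proof.
set Q := (X in _ <= X).
have Q_ge0 : 0 <= Q.
  by rewrite mulr_ge0 ?ler0n ?sumr_ge0 // => y _; exact: sqr_ge0.
have /andP[tv0 tvB] : 0 <= tv_norm mu nu <= Num.sqrt Q / 2.
  apply: tv_norm_le => A.
  rewrite ler_pdivlMr // -[X in _ * X]ger0_norm // -normrM -sqrtr_sqr.
  rewrite ler_sqrt //.
  pose f y := (if y \in A then 1 else -1) * (mu y - nu y).
  have <- : \sum_y f y = (measure_of mu A - measure_of nu A) * 2.
    have : \sum_y (mu y - nu y) = 0 by rewrite sumrB mass_eq subrr.
    rewrite (bigID (mem A)) /= => /eqP; rewrite addr_eq0 => /eqP e.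
    rewrite (bigID (mem A)) /= (eq_bigr (fun y => mu y - nu y)); last first.
      by move=> y yA; rewrite /f yA mul1r.
    rewrite [X in _ + X](eq_bigr (fun y => - (mu y - nu y))); last first.
      by move=> y yA; rewrite /f (negbTE yA) mulN1r.
    by rewrite sumrN -e /measure_of sumrB; ring.
  apply: le_trans (sqr_sum_le _) _; rewrite le_eqVlt; apply/orP; left.
  apply/eqP; congr (_ * _); apply: eq_bigr => y _; rewrite /f exprMn.
  by case: ifP; rewrite ?sqrrN expr1n mul1r.
have : tv_norm mu nu ^+ 2 <= (Num.sqrt Q / 2) ^+ 2.
  by rewrite ler_sqr // nnegrE // (le_trans tv0).
rewrite expr_div_n sqr_sqrtr //; lra.
Qed.

Lemma tv_norm_le1 : (forall y, 0 <= mu y) -> (forall y, 0 <= nu y) ->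
  \sum_y nu y = 1 -> 0 <= tv_norm mu nu <= 1.
Proof.
move=> mu0 nu0 nu1.
have meas01 (f : T -> R) A : (forall y, 0 <= f y) -> \sum_y f y = 1 ->
    0 <= measure_of f A <= 1.
  move=> f0 <-; rewrite [X in _ <= _ <= X](bigID (mem A)) /= /measure_of.
  by rewrite lerDl !sumr_ge0.
apply: tv_norm_le => A.
have /andP[a b] := meas01 nu A nu0 nu1.
have /andP[a' b'] := meas01 mu A mu0 (etrans mass_eq nu1).
rewrite ler_norml; lra.
Qed.

End TotalVariation.

(** * Random walks with real eigenfunctions *)

Section RealFourier.
Variables (R : realType) (G : finZmodType) (P : G -> R).

Lemma walk_law_ge0 : (forall g, 0 <= P g) ->
  forall l x y, 0 <= walk_law P l x y.
Proof.
move=> P0; elim=> [|l IH] x y /=; first exact: ler0n.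
by apply: sumr_ge0 => z _; rewrite mulr_ge0 // /walk_kernel.
Qed.

Lemma walk_law_eigen (f : G -> R) (lam : R) :
  (forall y, \sum_g P g * f (y + g) = lam * f y) ->
  forall l x, \sum_y walk_law P l x y * f y = lam ^+ l * f x.
Proof.
move=> fP; elim=> [|l IH] x /=.
  rewrite (bigD1 x) //= eqxx big1 ?addr0 // => y /negbTE ->.
  by rewrite mul0r.
under eq_bigr do rewrite mulr_suml.
rewrite exchange_big /= exprS -mulrA -IH mulr_sumr; apply: eq_bigr => z _.
rewrite mulrCA -fP mulr_sumr (reindex_inj (addrI z)) /=.
apply: eq_bigr => g _; rewrite /walk_kernel [z + g]addrC addrK.
by rewrite mulrA.
Qed.

Variables (I : finType) (chi : I -> G -> R) (lam : I -> R).
Hypothesis chi0 : forall i, chi i 0 = 1.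
Hypothesis chiN : forall i y, chi i (- y) = chi i y.
Hypothesis chi_orth : forall y, \sum_i chi i y = #|G|%:R * (y == 0)%:R.
Hypothesis chiP : forall i y, \sum_g P g * chi i (y + g) = lam i * chi i y.

(** Plancherel's identity without complex conjugation.  The square [p y ^+ 2] is
    written as a convolution with the delta function at 0, and the latter as
    the average of the even functions [chi i].  As translates of an
    eigenfunction have the same eigenvalue, summing over [z] and then over [y]
    produces a factor [lam i ^+ l] each time. *)
Lemma walk_law_plancherel l x :
  #|G|%:R * \sum_y walk_law P l x y ^+ 2 = \sum_i lam i ^+ (2 * l).
Proof.
set p := walk_law P l x.
have shiftP i a : \sum_y p y * chi i (y - a) = lam i ^+ l * chi i (x - a).
  apply: (walk_law_eigen (f := fun y => chi i (y - a))) => y.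
  by rewrite -chiP; apply: eq_bigr => g _; rewrite addrAC.
(* For fixed [y] only the term [z = y] survives, by [chi_orth]. *)
transitivity (\sum_y p y * \sum_z p z * \sum_i chi i (z - y)).
  rewrite mulr_sumr; apply: eq_bigr => y _.
  rewrite (bigD1 y) //= [X in _ + X]big1 ?addr0 => [|z zy].
    by rewrite chi_orth subrr eqxx mulr1; ring.
  by rewrite chi_orth subr_eq0 (negbTE zy) !mulr0.
transitivity (\sum_i \sum_y p y * (lam i ^+ l * chi i (x - y))).
  rewrite exchange_big; apply: eq_bigr => y _ /=.
  under eq_bigr do rewrite mulr_sumr.
  rewrite exchange_big /= mulr_sumr; apply: eq_bigr => i _.
  by rewrite shiftP.
apply: eq_bigr => i _.
(* Evenness turns [chi i (x - y)] into the translate [chi i (y - x)]. *)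
under eq_bigr do rewrite mulrCA -opprB chiN.
by rewrite -mulr_sumr shiftP subrr chi0 mulr1 mulnC exprM expr2.
Qed.

End RealFourier.

(** * Cosines at multiples of 2 pi / m *)

Section Chord.
Import numFieldNormedType.Exports.

(** Jordan's inequality, as an instance of concavity: if the graph of the sine
    were below the chord from 0 to pi/2 at [x], the mean value theorem would
    give a slope below that of the chord before [x] and one above it after
    [x], while the derivative decreases. *)
Lemma sin_ge_chord (R : realType) (x : R) : 0 <= x <= pi / 2 ->
  2 / pi * x <= sin x.
Proof.
have pi0 : 0 < pi :> R by exact: pi_gt0.
move=> /andP[x0 xpi]; rewrite leNgt; apply/negP => chord.
have {x0} x0 : 0 < x.
  rewrite lt_neqAle x0 andbT; apply/eqP => e; move: chord.
  by rewrite -e sin0 mulr0 ltxx.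
have {xpi} xpi : x < pi / 2.
  rewrite lt_neqAle xpi andbT; apply/eqP => e; move: chord.
  rewrite e sin_pihalf.
  have -> : 2 / pi * (pi / 2) = 1 :> R by rewrite mulrA divfK ?divff ?gt_eqF.
  by rewrite ltxx.
have sinc a b : {within `[a, b], continuous (@sin R)}%classic.
  by apply: continuous_subspaceT => z; exact: continuous_sin.
have [c1] := MVT x0 (fun z _ => is_derive_sin z) (sinc _ _).
rewrite in_itv /= sin0 !subr0 => /andP[c10 c1x] e1.
have [c2] := MVT xpi (fun z _ => is_derive_sin z) (sinc _ _).
rewrite in_itv /= sin_pihalf => /andP[c2x c2pi] e2.
have slope1 : cos c1 < 2 / pi by rewrite -(ltr_pM2r x0) -e1.
have slope2 : 2 / pi < cos c2.
  have d0 : 0 < pi / 2 - x by rewrite subr_gt0.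
  rewrite -(ltr_pM2r d0) -e2 mulrBr.
  have -> : 2 / pi * (pi / 2) = 1 :> R by rewrite mulrA divfK ?divff ?gt_eqF.
  by rewrite ltrD2l ltrN2.
have : cos c2 < cos c1.
  rewrite ltr_cos ?in_itv /=;
    [lra|apply/andP; split; lra|apply/andP; split; lra].
lra.
Qed.

End Chord.

Definition angle (R : realType) (m : nat) : R := pi *+ 2 / m%:R.

(** Subtraction is kept outside the natural numbers by putting [d] on the left
    of the congruence: the conclusion is about [b - d] modulo [m]. *)
Lemma cos_angle_congr (R : realType) (m a b d : nat) : (0 < m)%N ->
  (a + d = b %[mod m])%N ->
  cos (angle R m * a%:R) = cos (angle R m * b%:R - angle R m * d%:R).
Proof.
move=> m0 abd.
have mR : m%:R != 0 :> R by rewrite pnatr_eq0 -lt0n.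
rewrite -(periodicn (@cosD2pi R) (b %/ m)).
rewrite -[RHS](periodicn (@cosD2pi R) ((a + d) %/ m)); congr cos.
have : (a + d + b %/ m * m = b + (a + d) %/ m * m)%N.
  rewrite {1}(divn_eq (a + d) m) {2}(divn_eq b m) abd; ring.
move=> /(congr1 (fun k => k%:R : R)); rewrite !natrD !natrM => e.
apply: (mulIf mR); rewrite /angle -[LHS]addr0 -[in LHS](subrr (pi *+ 2 * d%:R)).
transitivity (pi *+ 2 * (a%:R + d%:R + (b %/ m)%:R * m%:R - d%:R) : R);
  last rewrite e; by field.
Qed.

Lemma cos_angle_mod (R : realType) (m a b : nat) : (0 < m)%N ->
  (a = b %[mod m])%N -> cos (angle R m * a%:R) = cos (angle R m * b%:R).
Proof.
by move=> m0 ab; rewrite (@cos_angle_congr R m a b 0) ?addn0 // mulr0 subr0.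
Qed.

(** By symmetry [N] may be replaced by [m - N], so that pi N / m is at most
    pi/2; then 1 - cos is twice the square of its sine, and Jordan's inequality
    bounds this sine below by 2 N / m. *)
Lemma cos_angle_gap (R : realType) (m N : nat) : (0 < N < m)%N ->
  8 / m%:R ^+ 2 <= 1 - cos (angle R m * N%:R).
Proof.
move=> /andP[N0 Nm]; have m0 : (0 < m)%N by apply: leq_trans Nm.
have mR : 0 < m%:R :> R by rewrite ltr0n.
have pi0 : 0 < pi :> R by exact: pi_gt0.
wlog Nhalf : N N0 Nm / (N * 2 <= m)%N.
  move=> H; have [|mN] := leqP (N * 2) m; first exact: H.
  have -> : cos (angle R m * N%:R) = cos (angle R m * (m - N)%N%:R).
    rewrite (@cos_angle_congr _ _ N 0 (m - N)) //; last first.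
      by rewrite subnKC ?(ltnW Nm) // modnn mod0n.
    by rewrite mulr0 sub0r cosN.
  by apply: H; rewrite ?subn_gt0 // ?ltn_subrL ?N0 // mulnBl leq_subLR; lia.
have -> : angle R m * N%:R = (pi * N%:R / m%:R) *+ 2.
  by rewrite /angle; field; rewrite gt_eqF.
set x := pi * N%:R / m%:R.
have NR : 1 <= N%:R :> R by rewrite ler1n.
have NhR : N%:R * 2 <= m%:R :> R by rewrite -natrM ler_nat.
have x_half : 0 <= x <= pi / 2.
  have -> : 0 <= x by rewrite /x !mulr_ge0 ?invr_ge0 ?ler0n // ltW.
  rewrite /= -(ler_pM2r mR) /x divfK ?gt_eqF // -mulrA ler_pM2l //; lra.
have sx : 2 / m%:R <= sin x.
  apply: le_trans (sin_ge_chord x_half).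
  have -> : 2 / pi * x = 2 * N%:R / m%:R.
    by rewrite /x !mulrA divfK ?gt_eqF.
  by rewrite ler_pM2r ?invr_gt0 // ler_peMr.
rewrite cos_mulr2n cos2sin2.
have : (2 / m%:R) ^+ 2 <= sin x ^+ 2.
  by rewrite ler_sqr ?nnegrE ?divr_ge0 // (le_trans _ sx) // divr_ge0.
rewrite expr_div_n; set u := m%:R ^+ 2; set v := sin x ^+ 2.
have -> : 8 / u = (2 ^+ 2 / u) * 2 by ring.
lra.
Qed.

(** * Cosine characters of the torus *)

Section Characters.
Variables (R : realType) (m n : nat).
Hypothesis m_gt0 : (0 < m)%N.
Implicit Types k y a : torus m n.

(** Computed on the representatives 0, ..., m - 1, so it is additive in each
    variable only modulo [m]; the angle 2 pi / m makes this harmless in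
    [chi]. *)
Definition phase k y : nat := \sum_(j < n) (k ord0 j : nat) * (y ord0 j : nat).

Definition chi k y : R := cos (angle R m * (phase k y)%:R).

Lemma chiC k y : chi k y = chi y k.
Proof. by rewrite /chi /phase; under eq_bigr do rewrite mulnC. Qed.

Lemma zmodD (a b : zmod m) : (nat_of_ord (a + b)%R = a + b %[mod m])%N.
Proof. by case: m m_gt0 a b => // m' _ a b; rewrite /= modn_mod. Qed.

Lemma zmod1 : (nat_of_ord (inZp 1 : zmod m) = 1 %[mod m])%N.
Proof. by case: m m_gt0 => // m' _; rewrite /= modn_mod. Qed.

Lemma phaseD k y a : (phase k (y + a)%R = phase k y + phase k a %[mod m])%N.
Proof.
rewrite /phase -big_split /=.
apply: (big_ind2 (fun s t : nat => s = t %[mod m])%N) => //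
  [s t s' t' e e'|j _].
  by rewrite -modnDm e e' modnDm.
by rewrite mxE -modnMmr zmodD modnMmr mulnDr.
Qed.

Lemma phase0 k : phase k 0 = 0%N.
Proof. by rewrite /phase big1 // => j _; rewrite mxE muln0. Qed.

Lemma chi0 k : chi k 0 = 1.
Proof. by rewrite /chi phase0 mulr0 cos0. Qed.

Lemma chiD k y a : chi k (y + a) =
  cos (angle R m * (phase k y)%:R + angle R m * (phase k a)%:R).
Proof.
by rewrite -mulrDr -natrD; apply: cos_angle_mod => //; exact: phaseD.
Qed.

Lemma chiB k y a : chi k (y - a) =
  cos (angle R m * (phase k y)%:R - angle R m * (phase k a)%:R).
Proof.
by apply: cos_angle_congr => //; rewrite -phaseD subrK.
Qed.

Lemma chiN k y : chi k (- y) = chi k y.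
Proof. by rewrite -sub0r chiB phase0 mulr0 sub0r cosN. Qed.

(** The real counterpart of the multiplicativity of complex characters. *)
Lemma chi_dAlembert k y a :
  chi k (y + a) + chi k (y - a) = 2 * chi k a * chi k y.
Proof. by rewrite chiD chiB cosD cosB /chi; ring. Qed.

Lemma chi_basis k j :
  chi k (basis_vec m j) = cos (angle R m * (k ord0 j : nat)%:R).
Proof.
apply: cos_angle_mod => //; rewrite /phase (bigD1 j) //= big1 => [|i ij].
  by rewrite mxE eqxx addn0 -modnMmr zmod1 modnMmr muln1.
by rewrite mxE (negbTE ij) muln0.
Qed.

Lemma coord_range k j : k ord0 j != 0 -> (0 < (k ord0 j : nat) < m)%N.
Proof.
move=> kj; rewrite lt0n (_ : (_ == _) = (k ord0 j == 0)) // kj /=.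
by rewrite -[X in (_ < X)%N](prednK m_gt0) ltn_ord.
Qed.

Lemma chi_basis_gap k j : k ord0 j != 0 ->
  8 / m%:R ^+ 2 <= 1 - chi k (basis_vec m j).
Proof. by move=> kj; rewrite chi_basis cos_angle_gap // coord_range. Qed.

(** If [y] has a nonzero coordinate [j], the sum [S] over [k] is unchanged when
    [k] is shifted by the basis vector or by its opposite, so d'Alembert's
    equation, with the roles of [k] and [y] exchanged, gives
    [S + S = 2 * chi y e * S]; but [chi y e < 1]. *)
Lemma chi_orth y : \sum_k chi k y = #|torus m n|%:R * (y == 0)%:R.
Proof.
have [->|y0] := eqVneq y 0.
  by rewrite (eq_bigr (fun=> 1)) ?sumr_const ?mulr1 // => k _; exact: chi0.
have [j yj] : exists j, y ord0 j != 0.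
  apply/existsP; rewrite -negb_forall; apply: contra y0 => /forallP y0.
  by apply/eqP/rowP => j; rewrite mxE (eqP (y0 j)).
under eq_bigr do rewrite chiC.
rewrite mulr0; set S := (LHS); pose e := basis_vec m j.
have gap : chi y e < 1.
  have : 0 < 8 / m%:R ^+ 2 :> R by rewrite divr_gt0 // exprn_gt0 // ltr0n.
  by have := chi_basis_gap yj; rewrite /e; lra.
have S2 : S + S = 2 * chi y e * S.
  rewrite {1}(reindex_inj (addIr e) : S = _).
  rewrite {1}(reindex_inj (addIr (- e)) : S = _).
  by rewrite -big_split mulr_sumr; apply: eq_bigr => k _; exact: chi_dAlembert.
have : S * (1 - chi y e) = 0 by lra.
by move/eqP; rewrite mulf_eq0 subr_eq0 [1 == _]gt_eqF // orbF => /eqP.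
Qed.

Definition lazy_eigenvalue k : R :=
  2^-1 + (2 * n%:R)^-1 * \sum_(j < n) chi k (basis_vec m j).

Lemma sum_lazy_step (f : torus m n -> R) :
  \sum_g lazy_step R g * f g =
  2^-1 * f 0 + (4 * n%:R)^-1 *
    \sum_(j < n) (f (basis_vec m j) + f (- basis_vec m j)).
Proof.
have sum_delta (a : R) h : \sum_g a * (g == h)%:R * f g = a * f h.
  rewrite (bigD1 h) //= eqxx mulr1 big1 ?addr0 // => g /negbTE ->.
  by rewrite mulr0 mul0r.
under eq_bigr do rewrite mulrDl mulr_suml.
rewrite big_split /= sum_delta exchange_big /= mulr_sumr; congr (_ + _).
apply: eq_bigr => j _; under eq_bigr do rewrite mulrDl.
by rewrite big_split /= !sum_delta mulrDr.
Qed.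

Lemma lazy_step_eigen k y :
  \sum_g lazy_step R g * chi k (y + g) = lazy_eigenvalue k * chi k y.
Proof.
rewrite (sum_lazy_step (fun g => chi k (y + g))) addr0.
under eq_bigr do rewrite chi_dAlembert.
have -> : (4 * n%:R)^-1 = 2^-1 * (2 * n%:R)^-1 :> R.
  by rewrite -invfM; congr _^-1; ring.
rewrite -mulr_suml -mulr_sumr /lazy_eigenvalue.
by set u := (_ * n%:R)^-1; field.
Qed.

Hypothesis n_gt0 : (0 < n)%N.

Lemma lazy_eigenvalueE k :
  lazy_eigenvalue k =
  1 - (2 * n%:R)^-1 * \sum_(j < n) (1 - chi k (basis_vec m j)).
Proof.
rewrite sumrB sumr_const card_ord /lazy_eigenvalue.
by field; rewrite pnatr_eq0 -lt0n.
Qed.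

Lemma lazy_eigenvalue0 : lazy_eigenvalue 0 = 1.
Proof.
rewrite lazy_eigenvalueE big1 ?mulr0 ?subr0 // => j _.
by rewrite chiC chi0 subrr.
Qed.

(** Laziness makes the spectrum nonnegative: the holding probability 1/2
    compensates for the average of the cosines, which has weight 1/2. *)
Lemma lazy_eigenvalue_ge0 k : 0 <= lazy_eigenvalue k.
Proof.
have nR : 0 < n%:R :> R by rewrite ltr0n.
have : - n%:R <= \sum_(j < n) chi k (basis_vec m j) :> R.
  rewrite -mulN1r mulr_natr -[in X in X <= _](card_ord n) -sumr_const.
  by apply: ler_sum => j _; exact: cos_geN1.
have n2 : 0 < 2 * n%:R :> R by rewrite mulr_gt0.
rewrite /lazy_eigenvalue => s; rewrite -(pmulr_rge0 _ n2).
rewrite mulrDr mulrA mulfV ?gt_eqF // mul1r.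
have -> : 2 * n%:R * 2^-1 = n%:R :> R by field.
lra.
Qed.

(** From [1 + t <= exp t]: each nonzero coordinate of [k] contributes a factor
    depending only on the gap 8 / m^2, and each zero coordinate a factor 1. *)
Lemma lazy_eigenvalue_le k (l : nat) :
  lazy_eigenvalue k ^+ (2 * l) <=
  \prod_(j < n) (if k ord0 j == 0 then 1
                  else expR (- (8 * l%:R / (n%:R * m%:R ^+ 2)))).
Proof.
have nR : 0 < n%:R :> R by rewrite ltr0n.
have mR : 0 < m%:R :> R by rewrite ltr0n.
set d : R := 8 / m%:R ^+ 2.
apply: (@le_trans _ _ (expR (- ((2 * n%:R)^-1 *
    \sum_(j < n) (1 - chi k (basis_vec m j)))) ^+ (2 * l))).
  rewrite lerXn2r ?nnegrE ?lazy_eigenvalue_ge0 ?expR_ge0 //.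
  by rewrite lazy_eigenvalueE expR_ge1Dx.
rewrite -expRM_natr mulr_sumr -sumrN mulr_suml expR_sum.
apply: ler_prod => j _; rewrite expR_ge0 /=.
have [kj|kj] := eqVneq.
  by rewrite chi_basis kj mulr0 cos0 subrr mulr0 oppr0 mul0r expR0.
rewrite ler_expR mulNr lerN2.
have -> : 8 * l%:R / (n%:R * m%:R ^+ 2) = (2 * n%:R)^-1 * d * (2 * l)%:R.
  by rewrite /d natrM; field; rewrite !gt_eqF.
by rewrite ler_wpM2r ?ler0n // ler_wpM2l ?chi_basis_gap.
Qed.

End Characters.

(** * The final inequality *)

(** From [1 - t / 3 <= exp (- t / 3)]. *)
Lemma expR_mul_cube_le1 (R : realType) (t : R) : t <= 3 ->
  expR t * (1 - t / 3) ^+ 3 <= 1.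
Proof.
move=> t3.
have -> : expR t = expR (t / 3) ^+ 3 by rewrite -expRM_natr; congr expR; field.
rewrite -exprMn exprn_ile1 //; first by rewrite mulr_ge0 ?expR_ge0 //; lra.
rewrite -[X in _ <= X](divff (lt0r_neq0 (expR_gt0 (t / 3)))).
rewrite ler_pM2l ?expR_gt0 // -expRN; exact: expR_ge1Dx.
Qed.

(** The slope 27/8 is the cube of 3/2, the inverse of the bound on [q] in
    [product_bound].  Bounding [exp t] by the inverse of the cube of [1 - t / 3]
    is the cheapest elementary estimate sharp enough up to 6/5: the square of
    [1 - t / 2] would not do. *)
Lemma expR_sub1_le (R : realType) (t : R) : 0 <= t -> t <= 6 / 5 ->
  expR t - 1 <= 27 / 8 * t.
Proof.
move=> t0 t1; have cube : expR t * (1 - t / 3) ^+ 3 <= 1.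
  by apply: expR_mul_cube_le1; lra.
pose s := t / 3.
have s0 : 0 <= s by rewrite /s; lra.
have s1 : s <= 2 / 5 by rewrite /s; lra.
have poly : 1 <= (1 - s) ^+ 3 * (1 + 81 / 8 * s).
  (* This cubic is the difference of the two sides, divided by [s / 8]. *)
  have : 0 <= 57 - 219 * s + 235 * s ^+ 2 - 81 * s ^+ 3 by nra.
  nra.
have c0 : 0 < (1 - s) ^+ 3 by rewrite exprn_gt0 //; lra.
have : expR t <= 1 + 81 / 8 * s.
  by rewrite -(ler_pM2r c0) [leRHS]mulrC (le_trans cube).
rewrite /s; lra.
Qed.

(** For [m = 1], [n = 1] and [m = n = 2] the inequality is polynomial and needs
    only [q <= 1].  Otherwise [m * n >= 6], hence [q < 2 / 3], and with
    [t = n (m - 1) q^4] the left side is at most [exp t - 1], where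
    [t <= m n q * q^3 <= 4 * (2 / 3)^3 < 6 / 5].  The factor [q^3 <= 8 / 27]
    then absorbs the constant of [expR_sub1_le]. *)
Lemma product_bound (R : realType) (m n : nat) (q : R) :
  (0 < m)%N -> (0 < n)%N -> 0 <= q <= 1 -> m%:R * n%:R * q < 4 ->
  (1 + (m%:R - 1) * q ^+ 4) ^+ n - 1 <= m%:R * n%:R * q.
Proof.
move=> m0 n0 /andP[q0 q1] E4.
have q4 : q ^+ 4 <= q by rewrite -[leRHS]expr1 ler_wiXn2l.
have q40 : 0 <= q ^+ 4 by rewrite exprn_ge0.
have mR : 1 <= m%:R :> R by rewrite ler1n.
have nR : 1 <= n%:R :> R by rewrite ler1n.
have [m1|m2] := leqP m 1.
  have -> : m = 1%N by apply/eqP; rewrite eqn_leq m1.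
  by rewrite subrr mul0r addr0 expr1n subrr !mulr_ge0.
have [n1|n2] := leqP n 1.
  have -> : n = 1%N by apply/eqP; rewrite eqn_leq n1.
  rewrite expr1 mulr1; nra.
have [mn|mn] := ltnP (m * n) 6.
  have -> : n = 2%N by nia.
  have -> : m = 2%N by nia.
  have : q ^+ 4 <= 1 by lra.
  nra.
pose t := n%:R * ((m%:R - 1) * q ^+ 4).
have mnR : 6 <= m%:R * n%:R :> R by rewrite -natrM ler_nat.
have q23 : q <= 2 / 3 by nra.
set E := m%:R * n%:R * q in E4 *.
have q3 : q ^+ 3 <= 8 / 27.
  have -> : 8 / 27 = (2 / 3) ^+ 3 :> R by field.
  by rewrite lerXn2r // nnegrE; lra.
have q30 : 0 <= q ^+ 3 by rewrite exprn_ge0.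
have E0 : 0 <= E by rewrite /E !mulr_ge0.
have tE : t <= E * q ^+ 3.
  have -> : E * q ^+ 3 = n%:R * (m%:R * q ^+ 4) by rewrite /E; ring.
  by rewrite /t ler_pM2l ?ltr0n // ler_wpM2r // gerBl.
have t0 : 0 <= t by rewrite /t mulr_ge0 // mulr_ge0 // subr_ge0.
have expt : (1 + (m%:R - 1) * q ^+ 4) ^+ n <= expR t.
  rewrite /t expRM_natl lerXn2r ?nnegrE ?expR_ge0 ?expR_ge1Dx //.
  by rewrite addr_ge0 // mulr_ge0 // subr_ge0.
have Eq : E * q ^+ 3 <= E * (8 / 27) by rewrite ler_wpM2l.
have : expR t - 1 <= 27 / 8 * t by apply: expR_sub1_le => //; lra.
lra.
Qed.

(** * The lazy walk on the torus *)

Lemma sum_torus_prod (R : comNzRingType) (m n : nat) (F : zmod m -> R) :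
  \sum_(k : torus m n) \prod_(j < n) F (k ord0 j) = (\sum_a F a) ^+ n.
Proof.
rewrite -[in RHS](card_ord n) -prodr_const bigA_distr_bigA /=.
rewrite (reindex (fun f : {ffun 'I_n -> zmod m} =>
  (\row_j f j : torus m n))) /=.
  by apply: eq_bigr => f _; apply: eq_bigr => j _; rewrite mxE.
exists (fun k : torus m n => [ffun j => k ord0 j]) => [f _|k _].
  by apply/ffunP => j; rewrite ffunE mxE.
by apply/rowP => j; rewrite mxE ffunE.
Qed.

Section TorusWalk.
Variables (R : realType) (m n : nat).
Hypotheses (m_gt0 : (0 < m)%N) (n_gt0 : (0 < n)%N).
Variables (l : nat) (x : torus m n).

Let law := walk_law (@lazy_step R m n) l x.

Lemma lazy_step_ge0 (g : torus m n) : 0 <= lazy_step R g.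
Proof.
have w0 : 0 <= (4 * n%:R)^-1 :> R by rewrite invr_ge0 mulr_ge0 // ler0n.
by rewrite addr_ge0 ?sumr_ge0 // => [|j _];
  rewrite ?addr_ge0 ?mulr_ge0 ?ler0n ?invr_ge0.
Qed.

(** The trivial character is the constant function 1, of eigenvalue 1. *)
Lemma lazy_law_sum : \sum_y law y = 1.
Proof.
have chi0_l y : chi R (0 : torus m n) y = 1 by rewrite chiC chi0.
have := walk_law_eigen (lazy_step_eigen R m_gt0 (0 : torus m n)) l x.
rewrite lazy_eigenvalue0 // expr1n mul1r chi0_l => <-.
by apply: eq_bigr => y _; rewrite chi0_l mulr1.
Qed.

Lemma torus_card_gt0 : 0 < #|torus m n|%:R :> R.
Proof. by rewrite ltr0n; apply/card_gt0P; exists x. Qed.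

Lemma uniform_sum : \sum_y @uniform_mass R (torus m n) y = 1.
Proof.
by rewrite sumr_const -[_^-1 *+ _]mulr_natr mulVf // gt_eqF ?torus_card_gt0.
Qed.

Lemma lazy_tv_le1 : 0 <= tv_norm law (@uniform_mass R (torus m n)) <= 1.
Proof.
apply: tv_norm_le1; last exact: uniform_sum.
- by rewrite lazy_law_sum uniform_sum.
- by move=> y; exact/walk_law_ge0/lazy_step_ge0.
- by move=> y; rewrite invr_ge0 ler0n.
Qed.

(** The subtracted 1 is the contribution of the trivial character: the squared
    L2 distance to uniform is the squared L2 norm minus the inverse of the
    cardinal, because the law has total mass 1. *)
Lemma lazy_tv_spectral : 4 * tv_norm law (@uniform_mass R (torus m n)) ^+ 2
  <= \sum_(k : torus m n) lazy_eigenvalue R k ^+ (2 * l) - 1.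
Proof.
apply: le_trans (tv_norm_sqr_le _) _; first by rewrite lazy_law_sum uniform_sum.
have N0 := torus_card_gt0; set N : R := #|torus m n|%:R in N0 *.
rewrite -(@walk_law_plancherel _ _ _ _ _ _ (@chi0 R m n) (@chiN R m n m_gt0)
  (@chi_orth R m n m_gt0) (@lazy_step_eigen R m n m_gt0) l x) -/law -/N.
under eq_bigr => y _.
  have -> : (law y - uniform_mass R y) ^+ 2 =
    law y ^+ 2 - 2 * N^-1 * law y + N^-1 ^+ 2.
    by rewrite /uniform_mass -/N; ring.
  over.
rewrite !big_split /= sumr_const sumrN -mulr_sumr lazy_law_sum.
rewrite -[_ ^+ 2 *+ _]mulr_natr -/N le_eqVlt; apply/orP; left; apply/eqP.
by field; rewrite gt_eqF.
Qed.

Lemma lazy_tv_product :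
  4 * tv_norm law (@uniform_mass R (torus m n)) ^+ 2 <=
  (1 + (m%:R - 1) * expR (- (8 * l%:R / (n%:R * m%:R ^+ 2)))) ^+ n - 1.
Proof.
apply: le_trans lazy_tv_spectral _; rewrite lerD2r.
set w := expR _.
apply: (@le_trans _ _
  (\sum_(k : torus m n) \prod_(j < n) (if k ord0 j == 0 then 1 else w))).
  by apply: ler_sum => k _; exact: lazy_eigenvalue_le.
rewrite (sum_torus_prod n (fun a : zmod m => if a == 0 then 1 else w)).
rewrite (bigD1 0) //= (eq_bigr (fun=> w)) => [|a /negbTE -> //].
rewrite sumr_const cardC1 card_ord /= -[w *+ _]mulr_natl.
by rewrite -subn1 natrB.
Qed.

End TorusWalk.

Theorem theorem7p1 (R : realType) (m n : nat) (m_gt0 : (0 < m)%N)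
    (n_gt0 : (0 < n)%N) (l : nat) (c : R)
    (hl : l%:R = 2^-1 * m%:R ^+ 2 *
                 ((n%:R + 1) * ln (m%:R * n%:R) + c * (n%:R + 1)))
    (x : torus m n) :
  4 * tv_norm (walk_law (@lazy_step R m n) l x) (@uniform_mass R (torus m n))
        ^+ 2
    <= (1 + (n%:R ^+ n)^-1) * expR (- c).
Proof.
have mR : 0 < m%:R :> R by rewrite ltr0n.
have nR : 0 < n%:R :> R by rewrite ltr0n.
pose L := ln (m%:R * n%:R) + c; pose q := expR (- L).
(* The exponent of a nonzero coordinate is [4 L (n + 1) / n]; the part
   [4 L / n] is dropped at the end. *)
have El : 8 * l%:R / (n%:R * m%:R ^+ 2) = 4 * L + 4 * (L / n%:R).
  by rewrite hl /L; field; rewrite !gt_eqF.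
(* [l] being a number of steps is what makes [q <= 1]. *)
have L0 : 0 <= L.
  have : 0 <= (2^-1 * m%:R ^+ 2 * (n%:R + 1)) * L.
    by rewrite [X in 0 <= X](_ : _ = l%:R) ?ler0n // hl /L; ring.
  by rewrite pmulr_rge0 // !mulr_gt0 ?exprn_gt0 ?invr_gt0 ?addr_gt0.
have Ec : expR (- c) = m%:R * n%:R * q.
  rewrite /q /L opprD expRD (expRN (ln _)) lnK ?posrE ?mulr_gt0 // mulrA.
  rewrite divff ?mul1r //.
  by rewrite gt_eqF ?mulr_gt0.
apply: (@le_trans _ _ (expR (- c))); last first.
  by rewrite ler_peMl ?expR_ge0 // lerDl invr_ge0 exprn_ge0.
rewrite Ec.
have [large|small] := leP 4 (m%:R * n%:R * q).
  apply: le_trans large; rewrite -[leRHS]mulr1 ler_pM2l //.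
  by have /andP[? ?] := lazy_tv_le1 R m_gt0 n_gt0 l x; rewrite exprn_ile1.
have q01 : 0 <= q <= 1 by rewrite expR_ge0 expR_le1 oppr_le0.
apply: le_trans (lazy_tv_product R m_gt0 n_gt0 l x) _.
apply: le_trans (product_bound m_gt0 n_gt0 q01 small).
rewrite lerD2r.
rewrite lerXn2r ?nnegrE ?addr_ge0 ?mulr_ge0 ?expR_ge0 ?subr_ge0 ?ler1n //.
rewrite lerD2l ler_wpM2l ?subr_ge0 ?ler1n // /q -expRM_natr ler_expR El.
have : 0 <= L / n%:R by rewrite divr_ge0 // ltW.
lra.
Qed.
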